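(* Suppose $\kappa\in\mathbb N$, $\kappa>1$, $\eta\in\mathbb N\cup\{\infty\}$ and let $a:=\{a_n\}_{n=1}^\kappa\subseteq(0,\infty)$. Then the following are equivalent: (i) there exist a discrete measure space $(X,\mathscr A,\mu)$ and a self-map $\phi\colon X\to X$ of the one-circuit form described in the context (with the given $\kappa$ and $\eta$) such that $\mu(x_n)=a_n$ for $n\in\{1,\ldots,\kappa\}$ and $C_\phi\in\boldsymbol B(L^2(\mu))$ is a $2$-isometry; (ii) the sequence $\{(\triangle a)_n\}_{n=1}^{\kappa-1}$, where $(\triangle a)_n=a_{n+1}-a_n$, is constant and $(\triangle a)_1>0$.
   Context: One-circuit form. $\mathbb N=\{1,2,\ldots\}$. For $\kappa\in\mathbb N$ and $\eta\in\mathbb N\cup\{\infty\}$ let $J_{[1,\eta]}=\{i\in\mathbb N: i\le\eta\}$ (so $J_{[1,\infty]}=\mathbb N$), and let $X=\{x_1,\ldots,x_\kappa\}\cup\{x_{i,j}: i\in J_{[1,\eta]},\, j\in\mathbb N\}$, all the listed points being distinct. $\mathscr A$ is the $\sigma$-algebra of all subsets of $X$ and $\mu$ is a positive measure on $\mathscr A$ with $\mu(x):=\mu(\{x\})\in(0,\infty)$ for all $x\in X$ (this makes $(X,\mathscr A,\mu)$ a discrete measure space). The map $\phi\colon X\to X$ is given by $\phi(x_{i,j})=x_{i,j-1}$ for $j\ge2$, $\phi(x_{i,1})=x_\kappa$, $\phi(x_1)=x_\kappa$, and $\phi(x_i)=x_{i-1}$ for $2\le i\le\kappa$. $C_\phi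 f=f\circ\phi$ is the composition operator in the complex space $L^2(\mu)=L^2(X,\mathscr A,\mu)$, and $C_\phi\in\boldsymbol B(L^2(\mu))$ means that it is everywhere defined and bounded on $L^2(\mu)$. A bounded operator $T$ on a Hilbert space is a $2$-isometry if $I-2T^*T+T^{*2}T^2=0$. *)

(* Defs.v *)
From HB Require Import structures.
From mathcomp Require Import all_boot all_order all_algebra.
From mathcomp Require Import complex.
From mathcomp Require Import all_classical all_reals all_analysis.

Set Implicit Arguments.
Unset Strict Implicit.
Unset Printing Implicit Defensive.

Import Order.TTheory GRing.Theory Num.Theory.
Import numFieldNormedType.Exports.

Local Open Scope classical_set_scope.
Local Open Scope ring_scope.
Local Open Scope complex_scope.

(* [option nat] encodes N u {oo}: [Some n] is n (to be taken >= 1), [None] is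
   oo.  Indices start at 1, as in N = {1, 2, ...}. *)
Definition in_J (eta : option nat) (i : nat) : bool :=
  (0 < i)%N && (if eta is Some n then (i <= n)%N else true).

(* [x] and [y] are used only at indices 1 <= i <= kappa, respectively
   i \in J_[1,eta] and j >= 1; their values elsewhere are irrelevant.  [y i j]
   stands for x_{i,j}. *)
Record one_circuit_form (X : Type) (kappa : nat) (eta : option nat)
    (phi : X -> X) (x : nat -> X) (y : nat -> nat -> X) : Prop := {
  circuit_cover : forall z : X,
    (exists2 i, (1 <= i <= kappa)%N & z = x i) \/
    (exists i j, [/\ in_J eta i, (1 <= j)%N & z = y i j]);
  circuit_x_inj : forall i i', (1 <= i <= kappa)%N -> (1 <= i' <= kappa)%N ->
    x i = x i' -> i = i';
  circuit_y_inj : forall i j i' j', in_J eta i -> (1 <= j)%N ->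
    in_J eta i' -> (1 <= j')%N -> y i j = y i' j' -> i = i' /\ j = j';
  circuit_x_neq_y : forall i i' j, (1 <= i <= kappa)%N ->
    in_J eta i' -> (1 <= j)%N -> x i <> y i' j;
  circuit_phi_y : forall i j, in_J eta i -> (2 <= j)%N ->
    phi (y i j) = y i j.-1;
  circuit_phi_y1 : forall i, in_J eta i -> phi (y i 1%N) = x kappa;
  circuit_phi_x1 : phi (x 1%N) = x kappa;
  circuit_phi_x : forall i, (2 <= i <= kappa)%N -> phi (x i) = x i.-1 }.

Definition discrete_measure_space (R : realType) (d : measure_display)
    (X : measurableType d) (mu : {measure set X -> \bar R}) : Prop :=
  (forall A : set X, measurable A) /\
  (forall z : X, (0 < mu [set z] < +oo)%E).

Section ComplexL2.
Context (R : realType) (d : measure_display) (X : measurableType d).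
Variable mu : {measure set X -> \bar R}.
Implicit Types (f g : X -> R[i]) (T S : (X -> R[i]) -> X -> R[i]).

Definition L2norm f : \bar R :=
  'N[mu]_2%:E[EFin \o (@Normc.normc R) \o f]%E.

(* Elements of L^2(mu) are represented by functions; equality in L^2(mu) is
   equality mu-almost everywhere. *)
Definition L2 f : Prop :=
  [/\ measurable_fun setT (fun z => complex.Re (f z)),
      measurable_fun setT (fun z => complex.Im (f z))
    & (L2norm f < +oo)%E].

Definition cintegral f : R[i] :=
  (\int[mu]_z complex.Re (f z)) +i* (\int[mu]_z complex.Im (f z)).

Definition L2dot f g : R[i] := cintegral (fun z => f z * conjc (g z)).

(* T \in B(L^2(mu)).  Linearity and boundedness force T to send almost
   everywhere equal functions to almost everywhere equal functions. *)
Definition bounded_operator T : Prop :=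
  [/\ forall f, L2 f -> L2 (T f),
      forall (c : R[i]) f g, L2 f -> L2 g ->
        T (fun z => c * f z + g z) = (fun z => c * T f z + T g z) %[ae mu]
    & exists M : R, forall f, L2 f -> (L2norm (T f) <= M%:E * L2norm f)%E].

(* S = T^*; the identity determines S f almost everywhere, for f in L^2. *)
Definition is_adjoint T S : Prop :=
  (forall f, L2 f -> L2 (S f)) /\
  (forall f g, L2 f -> L2 g -> L2dot (T f) g = L2dot f (S g)).

(* I - 2 T^* T + T^*^2 T^2 = 0 on L^2(mu); T^* is introduced by an existential
   since it exists and is unique for every bounded operator T. *)
Definition two_isometry T : Prop :=
  exists S, is_adjoint T S /\
    forall f, L2 f ->
      (fun z => f z - 2 * S (T f) z + S (S (T (T f))) z) = cst 0 %[ae mu].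

End ComplexL2.

Definition composition_operator (X Y : Type) (phi : X -> X) (f : X -> Y) :
  X -> Y := f \o phi.

Definition forward_diff (R : realType) (a : nat -> R) (n : nat) : R :=
  a n.+1 - a n.

(* Main.v *)
Require Import Defs.
From HB Require Import structures.
From mathcomp Require Import all_boot all_order all_algebra.
From mathcomp Require Import complex.
From mathcomp Require Import ring lra zify.
From mathcomp Require Import all_classical all_reals all_analysis.

Set Implicit Arguments.
Unset Strict Implicit.
Unset Printing Implicit Defensive.

Import Order.TTheory GRing.Theory Num.Theory.
Import numFieldNormedType.Exports.

Local Open Scope classical_set_scope.
Local Open Scope ring_scope.

(** Write m(z) for the mass of the point z.  Pairing the identity
    I - 2 T* T + T*^2 T^2 = 0 with the indicator of {z} gives, for T = C_phi,
      m(z) - 2 mu(phi^-1 {z}) + mu(phi^-1 (phi^-1 {z})) = 0,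
    and everything follows from this second-difference equation.

    Necessity.  For i < kappa the only preimage of x_i is x_(i+1).  At x_i with
    i + 2 <= kappa the equation says a_i - 2 a_(i+1) + a_(i+2) = 0, so that a is
    arithmetic, with difference delta say.  At x_(kappa-1) it says
    mu(phi^-1 {x_kappa}) = 2 a_kappa - a_(kappa-1) = a_1 + kappa delta.  That
    preimage contains x_1 and also x_(1,1), so its mass exceeds a_1, and
    delta > 0.

    Sufficiency.  On the branches the masses must be affine in j, and the
    equation at x_kappa, compared with the one at x_(kappa-1), forces them to be
    constant: m(x_(i,j)) = c_i with c_i > 0 and sum_i c_i = kappa delta.  For
    the c_i one can take kappa delta times the consecutive differences of the
    sequence 1, 1/2, 1/3, ... replaced by 0 from its (eta+1)-st term on; these
    telescope to a total of 1, for finite and infinite eta alike.  With these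
    masses the ratio h(z) = mu(phi^-1 {z}) / m(z) is 1 + delta / a_i at x_i and
    1 on the branches, hence bounded.

    That a bounded h and the second-difference equation make C_phi a bounded
    2-isometry holds on every countable discrete space
    (bounded_composition_operator, two_isometry_composition_operator).  The
    adjoint is the fiber mean
      (T* f)(z) = m(z)^-1 int_(phi^-1 {z}) f,
    as one sees by cutting an integral along the fibers of phi; it maps L^2 to
    L^2 by the Cauchy-Schwarz inequality on each fiber.  Then T* T is the
    multiplication by h, and T*^2 T^2 is the multiplication by the function
    m(z)^-1 int_(phi^-1 {z}) h = 2 h(z) - 1. *)

(** * Integrals cut along the fibers of a map *)

Section FiberIntegrals.
Context (R : realType) (d : measure_display) (X : measurableType d).
Variables (mu : {measure set X -> \bar R}) (code : X -> nat).
Hypothesis mX : forall A : set X, measurable A.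
Hypothesis codeI : injective code.

Lemma discrete_measurable_fun d' (Y : sigmaRingType d') (D : set X)
  (f : X -> Y) : measurable_fun D f.
Proof. by move=> _ B _; exact: mX. Qed.

(** An enumeration of the points through their codes: a level has at most one
    point, and the levels, being indexed by nat, fit countable additivity. *)
Definition level (n : nat) : set X := [set z | code z = n].

Lemma level_set1 n : level n = set0 \/ exists z, level n = [set z].
Proof.
have [[z zn]|nz] := pselect (exists z, code z = n).
  right; exists z; apply/seteqP; split => [w wn|_ ->//].
  by apply: codeI; rewrite zn.
by left; apply/seteqP; split => // w wn; apply: nz; exists w.
Qed.

Lemma preimage_level_trivIset (f : X -> X) :
  trivIset setT (fun n => f @^-1` level n).
Proof. by move=> i j _ _ [z []]; rewrite /level /= => <- <-. Qed.

Lemma preimage_level_cover (f : X -> X) :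
  \bigcup_n f @^-1` level n = setT.
Proof. by apply/seteqP; split => // z _; exists (code (f z)). Qed.

Lemma ge0_integral_preimage_level (f : X -> X) (F : X -> \bar R) :
  (forall z, 0 <= F z)%E ->
  (\int[mu]_z F z = \sum_(n <oo) \int[mu]_(z in f @^-1` level n) F z)%E.
Proof.
move=> F0; rewrite -{1}(preimage_level_cover f) ge0_integral_bigcup//.
exact: preimage_level_trivIset.
Qed.

Lemma integral_preimage_level (f : X -> X) (F : X -> \bar R) :
  mu.-integrable setT F ->
  (\int[mu]_z F z = \sum_(n <oo) \int[mu]_(z in f @^-1` level n) F z)%E.
Proof.
move=> iF; rewrite -{1}(preimage_level_cover f) integral_bigcup//.
- exact: preimage_level_trivIset.
- by rewrite preimage_level_cover.
Qed.

(** With f or g the identity, this compares an integral over X summed point by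
    point with one summed fiber by fiber. *)
Lemma ge0_le_integral_preimage (f g : X -> X) (F G : X -> \bar R) :
  (forall z, 0 <= F z)%E -> (forall z, 0 <= G z)%E ->
  (forall z, \int[mu]_(w in f @^-1` [set z]) F w <=
             \int[mu]_(w in g @^-1` [set z]) G w)%E ->
  (\int[mu]_z F z <= \int[mu]_z G z)%E.
Proof.
move=> F0 G0 FG.
rewrite (@ge0_integral_preimage_level f F)//.
rewrite (@ge0_integral_preimage_level g G)//.
apply: lee_nneseries => [n _ _|n _]; first exact: integral_ge0.
have [->|[z ->]] := level_set1 n; last exact: FG.
by rewrite !preimage_set0 !integral_set0.
Qed.

Lemma eq_integral_preimage (f g : X -> X) (F G : X -> \bar R) :
  mu.-integrable setT F -> mu.-integrable setT G ->
  (forall z, \int[mu]_(w in f @^-1` [set z]) F w =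
             \int[mu]_(w in g @^-1` [set z]) G w)%E ->
  (\int[mu]_z F z = \int[mu]_z G z)%E.
Proof.
move=> iF iG FG.
rewrite (@integral_preimage_level f F)// (@integral_preimage_level g G)//.
apply: eq_eseriesr => n _.
have [->|[z ->]] := level_set1 n; last exact: FG.
by rewrite !preimage_set0 !integral_set0.
Qed.

Lemma integral_point (F : X -> \bar R) z : (0 <= F z)%E ->
  (\int[mu]_(w in [set z]) F w = F z * mu [set z])%E.
Proof.
move=> Fz0; rewrite (eq_integral (cst (F z))) ?integral_cst//.
by move=> w; rewrite inE => ->.
Qed.

Lemma Rintegral_point (F : X -> R) z :
  \int[mu]_(w in [set z]) F w = F z * fine (mu [set z]).
Proof.
have /eq_Rintegral -> : {in [set z], F =1 cst (F z)}.
  by move=> w; rewrite inE => ->.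
exact: Rintegral_cst.
Qed.

Definition sqintegrable (u : X -> R) : Prop :=
  (\int[mu]_z (u z ^+ 2)%:E < +oo)%E.

Lemma sqintegrable_sqr u D : sqintegrable u ->
  mu.-integrable D (EFin \o (fun z => u z ^+ 2)).
Proof.
move=> ui; apply: (@integrableS _ _ _ mu setT) => //.
apply/integrableP; split; first exact: discrete_measurable_fun.
rewrite (_ : integral _ _ _ = \int[mu]_z (u z ^+ 2)%:E)%E//.
by apply: eq_integral => z _ /=; rewrite ger0_norm// sqr_ge0.
Qed.

(** By 2 |u v| <= u^2 + v^2. *)
Lemma sqintegrableM u v D : sqintegrable u -> sqintegrable v ->
  mu.-integrable D (EFin \o (fun z => u z * v z)).
Proof.
move=> ui vi.
have := integrableD (mX D) (sqintegrable_sqr D ui) (sqintegrable_sqr D vi).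
apply: le_integrable => //.
move=> z _ /=; rewrite lee_fin.
rewrite (ger0_norm (addr_ge0 (sqr_ge0 (u z)) (sqr_ge0 (v z)))).
have : 0 <= (`|u z| - `|v z|) ^+ 2 by exact: sqr_ge0.
have := sqr_ge0 (u z); have := sqr_ge0 (v z).
rewrite normrM sqrrB -!normrX !(ger0_norm (sqr_ge0 _)).
have := normr_ge0 (u z); have := normr_ge0 (v z); nra.
Qed.

Lemma finite_integrable_cst D (k : R) : (mu D < +oo)%E ->
  mu.-integrable D (EFin \o cst k).
Proof.
move=> Doo; apply: measurable_bounded_integrable => //.
exact: bounded_cst.
Qed.

(** By 2 |u| <= u^2 + 1. *)
Lemma sqintegrable_integrable D u : (mu D < +oo)%E -> sqintegrable u ->
  mu.-integrable D (EFin \o u).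
Proof.
move=> Doo ui.
have := integrableD (mX D) (sqintegrable_sqr D ui)
  (finite_integrable_cst 1 Doo).
apply: le_integrable => //.
move=> z _ /=; rewrite lee_fin.
rewrite (ger0_norm (addr_ge0 (sqr_ge0 (u z)) ler01)).
have : 0 <= (`|u z| - 1) ^+ 2 by exact: sqr_ge0.
rewrite sqrrB -!normrX (ger0_norm (sqr_ge0 _)) mulr1 expr1n.
have := sqr_ge0 (u z); have := normr_ge0 (u z); nra.
Qed.

(** The Cauchy-Schwarz inequality against the constant 1: the quadratic
    polynomial c |-> int_D (u - c)^2 is nonnegative at the mean value of u. *)
Lemma sqr_Rintegral_le D u : (mu D < +oo)%E -> sqintegrable u ->
  (\int[mu]_(z in D) u z) ^+ 2 <=
  fine (mu D) * \int[mu]_(z in D) (u z ^+ 2).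
Proof.
move=> Doo ui; set I := Rintegral _ _ _; set Q := Rintegral _ _ _.
have iu := sqintegrable_integrable Doo ui.
have iu2 := sqintegrable_sqr D ui.
have quad c : 0 <= Q - 2 * c * I + c ^+ 2 * fine (mu D).
  have : 0 <= \int[mu]_(z in D) ((u z - c) ^+ 2).
    by apply: Rintegral_ge0 => z _; exact: sqr_ge0.
  congr (0 <= _).
  have -> : \int[mu]_(z in D) ((u z - c) ^+ 2) =
      \int[mu]_(z in D) ((u z ^+ 2 - (2 * c) * u z) + c ^+ 2).
    by apply: eq_Rintegral => z _; ring.
  have iZ : mu.-integrable D (EFin \o (fun z => 2 * c * u z)).
    exact: (@integrableZl _ _ _ _ _ (mX D) (2 * c) (EFin \o u)).
  have iB : mu.-integrable D (EFin \o (fun z => u z ^+ 2 - 2 * c * u z)).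
    exact: (@integrableB _ _ _ _ _ (mX D) _ _ iu2 iZ).
  rewrite RintegralD//; last exact: finite_integrable_cst.
  by rewrite RintegralB// RintegralZl// Rintegral_cst.
have [m0|m0] := eqVneq (fine (mu D)) 0.
  have mD0 : mu D = 0%E.
    by rewrite -[mu D]fineK ?m0// ge0_fin_numE.
  by rewrite /I /Rintegral null_set_integral// expr0n /= m0 mul0r.
have mp : 0 < fine (mu D) by rewrite lt_neqAle eq_sym m0 fine_ge0.
have := quad (I / fine (mu D)).
rewrite -(ler_pM2l mp) mulr0 => quadI.
rewrite -subr_ge0 (le_trans quadI)// le_eqVlt; apply/orP; left.
by apply/eqP; field.
Qed.

Variable phi : X -> X.

Definition fiber z : set X := phi @^-1` [set z].

Hypothesis mu_pt : forall z, (0 < mu [set z] < +oo)%E.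
Variable C : R.
Hypothesis C0 : 0 <= C.
Hypothesis mu_fiber_le : forall z, (mu (fiber z) <= C%:E * mu [set z])%E.

Let m z : R := fine (mu [set z]).

Let m_gt0 z : 0 < m z.
Proof. by have /andP[m0 moo] := mu_pt z; rewrite fine_gt0// m0. Qed.

Let mE z : mu [set z] = (m z)%:E.
Proof. by have /andP[_ moo] := mu_pt z; rewrite fineK// ge0_fin_numE. Qed.

Let fiber_fin z : (mu (fiber z) < +oo)%E.
Proof. by rewrite (le_lt_trans (mu_fiber_le z))// mE ltry. Qed.

Let fiberE z : mu (fiber z) = (fine (mu (fiber z)))%:E.
Proof. by rewrite fineK// ge0_fin_numE. Qed.

(** On the fiber of z the function F \o phi is the constant F z, so that the
    fiber contributes F z * mu (fiber z) <= C * (F z * mu [set z]). *)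
Lemma ge0_integral_comp_le (F : X -> \bar R) : (forall z, 0 <= F z)%E ->
  (\int[mu]_z F (phi z) <= C%:E * \int[mu]_z F z)%E.
Proof.
move=> F0; rewrite -ge0_integralZl//.
apply: (@ge0_le_integral_preimage phi id) => // z; first by rewrite mule_ge0.
rewrite preimage_id integral_point ?mule_ge0//.
rewrite (@eq_integral _ _ _ mu (fiber z) (cst (F z))).
  rewrite integral_cst// [leRHS]muleAC [leRHS]muleC.
  exact: lee_wpmul2l.
by move=> w; rewrite inE /fiber /= => ->.
Qed.

Lemma sqintegrable_comp u : sqintegrable u -> sqintegrable (u \o phi).
Proof.
move=> ui.
have := @ge0_integral_comp_le (fun z => (u z ^+ 2)%:E).
move=> /(_ (fun z => sqr_ge0 (u z))) /le_lt_trans; apply.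
by rewrite lte_mul_pinfty.
Qed.

(** The value at z of the adjoint of the composition with phi. *)
Definition fiber_mean (v : X -> R) (z : X) : R :=
  (fine (mu [set z]))^-1 * \int[mu]_(w in fiber z) v w.

(** Fiber by fiber: by Cauchy-Schwarz and the bound on the mass of the fiber,
    m(z) * (fiber_mean v z)^2 <= C * int_(fiber z) v^2. *)
Lemma sqintegrable_fiber_mean v :
  sqintegrable v -> sqintegrable (fiber_mean v).
Proof.
move=> vi; rewrite /sqintegrable.
have sq0 (u : X -> R) z : (0 <= (u z ^+ 2)%:E)%E by rewrite lee_fin sqr_ge0.
suff : (\int[mu]_z (fiber_mean v z ^+ 2)%:E <=
        C%:E * \int[mu]_z (v z ^+ 2)%:E)%E.
  by move=> /le_lt_trans; apply; rewrite lte_mul_pinfty.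
rewrite -ge0_integralZl//.
apply: (@ge0_le_integral_preimage id phi) => // z; first by rewrite mule_ge0.
rewrite preimage_id integral_point// ge0_integralZl//.
rewrite mE -[X in (_ <= _ * X)%E]fineK; last first.
  exact: integrable_fin_num (sqintegrable_sqr _ vi).
rewrite -!EFinM lee_fin -/(Rintegral mu (fiber z) (fun w => v w ^+ 2)).
set Q := Rintegral _ _ _.
rewrite /fiber_mean -/(m z) exprMn.
have Q0 : 0 <= Q by apply: Rintegral_ge0 => w _; exact: sqr_ge0.
have := sqr_Rintegral_le (fiber_fin z) vi; rewrite -/Q.
set I := Rintegral _ _ _ => IQ.
have hC : fine (mu (fiber z)) <= C * m z.
  by rewrite -lee_fin -fiberE EFinM -mE.
have -> : (m z)^-1 ^+ 2 * I ^+ 2 * m z = (m z)^-1 * I ^+ 2.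
  by field; rewrite gt_eqF.
rewrite ler_pdivrMl//; apply: (le_trans IQ).
by rewrite mulrA [m z * C]mulrC ler_wpM2r.
Qed.

(** Both integrands have the integral u z * int_(fiber z) v over, respectively,
    the fiber of z and the point z. *)
Lemma Rintegral_comp_fiber_mean u v : sqintegrable u -> sqintegrable v ->
  \int[mu]_z (u (phi z) * v z) = \int[mu]_z (u z * fiber_mean v z).
Proof.
move=> ui vi; congr fine.
apply: (@eq_integral_preimage phi id).
- exact: sqintegrableM (sqintegrable_comp ui) vi.
- exact: sqintegrableM (sqintegrable_fiber_mean vi).
move=> z; rewrite preimage_id.
rewrite -[LHS]fineK; last first.
  exact: integrable_fin_num (sqintegrableM _ (sqintegrable_comp ui) vi).
rewrite -[RHS]fineK; last first.
  exact: integrable_fin_num (sqintegrableM _ ui (sqintegrable_fiber_mean vi)).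
congr EFin.
rewrite -[RHS]/(Rintegral mu [set z] (fun w => u w * fiber_mean v w)).
rewrite -[LHS]/(Rintegral mu (fiber z) (fun w => u (phi w) * v w)).
have /eq_Rintegral -> :
    {in fiber z, (fun w => u (phi w) * v w) =1 (fun w => u z * v w)}.
  by move=> w; rewrite inE /fiber /= => ->.
rewrite RintegralZl//; last exact: sqintegrable_integrable.
rewrite Rintegral_point /fiber_mean -/(m z).
by field; rewrite gt_eqF.
Qed.

End FiberIntegrals.

(** * Complex square-integrable functions *)

Section ComplexL2Discrete.
Local Open Scope complex_scope.
Context (R : realType) (d : measure_display) (X : measurableType d).
Variable mu : {measure set X -> \bar R}.

Lemma L2normE (f : X -> R[i]) : L2norm mu f =
  ((\int[mu]_z (complex.Re (f z) ^+ 2 + complex.Im (f z) ^+ 2)%:E) `^ 2^-1)%E.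
Proof.
rewrite /L2norm Lnorm.unlock /Lnorm.body; congr (_ `^ _)%E.
apply: eq_integral => z _ /=.
case: (f z) => p q /=.
rewrite ger0_norm ?sqrtr_ge0// powR_mulrn ?sqrtr_ge0// sqr_sqrtr//.
by rewrite addr_ge0 ?sqr_ge0.
Qed.

Hypothesis mX : forall A : set X, measurable A.

Lemma L2P (f : X -> R[i]) : L2 mu f <->
  sqintegrable mu (fun z => complex.Re (f z)) /\
  sqintegrable mu (fun z => complex.Im (f z)).
Proof.
have normD : (\int[mu]_z (complex.Re (f z) ^+ 2 + complex.Im (f z) ^+ 2)%:E =
    \int[mu]_z (complex.Re (f z) ^+ 2)%:E +
    \int[mu]_z (complex.Im (f z) ^+ 2)%:E)%E.
  by rewrite -ge0_integralD// => z _; rewrite lee_fin sqr_ge0.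
split=> [[_ _]|[fr fi]].
  rewrite L2normE normD => /lty_poweRy; rewrite invr_neq0// => /(_ isT) foo.
  split; apply: le_lt_trans foo.
    by rewrite leeDl// integral_ge0// => z _; rewrite lee_fin sqr_ge0.
  by rewrite leeDr// integral_ge0// => z _; rewrite lee_fin sqr_ge0.
split; try exact: discrete_measurable_fun.
by rewrite L2normE normD poweR_lty// lte_add_pinfty.
Qed.

Lemma L2dotE (f g : X -> R[i]) : L2dot mu f g =
  (\int[mu]_z (complex.Re (f z) * complex.Re (g z) +
               complex.Im (f z) * complex.Im (g z))) +i*
  (\int[mu]_z (complex.Im (f z) * complex.Re (g z) -
               complex.Re (f z) * complex.Im (g z))).
Proof.
rewrite /L2dot /cintegral; congr (_ +i* _); apply: eq_Rintegral => z _;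
  case: (f z) => p q; case: (g z) => r s /=; ring.
Qed.

Lemma L2dot_split (f g : X -> R[i]) : L2 mu f -> L2 mu g -> L2dot mu f g =
  (\int[mu]_z (complex.Re (f z) * complex.Re (g z)) +
   \int[mu]_z (complex.Im (f z) * complex.Im (g z))) +i*
  (\int[mu]_z (complex.Im (f z) * complex.Re (g z)) -
   \int[mu]_z (complex.Re (f z) * complex.Im (g z))).
Proof.
move=> /L2P[fr fi] /L2P[gr gi]; rewrite L2dotE.
by rewrite RintegralD ?RintegralB//; exact: sqintegrableM.
Qed.

(** * Composition operators that are 2-isometries *)

Section CompositionOperator.
Variables (phi : X -> X) (code : X -> nat).
Hypothesis codeI : injective code.
Hypothesis mu_pt : forall z, (0 < mu [set z] < +oo)%E.
Variable C : R.
Hypothesis C0 : 0 <= C.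
Hypothesis mu_fiber_le : forall z,
  (mu (fiber phi z) <= C%:E * mu [set z])%E.

Let T := @composition_operator X R[i] phi.

Definition cfiber_mean (f : X -> R[i]) (z : X) : R[i] :=
  fiber_mean mu phi (fun w => complex.Re (f w)) z +i*
  fiber_mean mu phi (fun w => complex.Im (f w)) z.

Lemma L2_comp f : L2 mu f -> L2 mu (T f).
Proof.
by move=> /L2P[fr fi]; apply/L2P; split;
  [exact: (sqintegrable_comp mX codeI C0 mu_fiber_le fr)
  |exact: (sqintegrable_comp mX codeI C0 mu_fiber_le fi)].
Qed.

Lemma bounded_composition_operator : bounded_operator mu T.
Proof.
split; first exact: L2_comp.
  by move=> c f g _ _; exact: aeW.
exists (C `^ 2^-1) => f _; rewrite !L2normE -poweR_EFin -poweRM//; last first.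
  by apply: integral_ge0 => z _; rewrite lee_fin addr_ge0 ?sqr_ge0.
have sq0 z : (0 <= (complex.Re (f z) ^+ 2 + complex.Im (f z) ^+ 2)%:E)%E.
  by rewrite lee_fin addr_ge0 ?sqr_ge0.
apply: gt0_ler_poweR; rewrite ?invr_ge0// ?in_itv/= ?leey ?andbT.
- by apply: integral_ge0 => z _; exact: (sq0 (phi z)).
- by rewrite mule_ge0 ?lee_fin ?integral_ge0.
exact: (ge0_integral_comp_le mX codeI C0 mu_fiber_le).
Qed.

Lemma is_adjoint_cfiber_mean : is_adjoint mu T cfiber_mean.
Proof.
have mean_sq := sqintegrable_fiber_mean mX codeI mu_pt C0 mu_fiber_le.
have adj := Rintegral_comp_fiber_mean mX codeI mu_pt C0 mu_fiber_le.
have L2mean f : L2 mu f -> L2 mu (cfiber_mean f).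
  by move=> /L2P[fr fi]; apply/L2P; split; exact: mean_sq.
split=> // f g fL gL.
rewrite !L2dot_split//; [|exact: L2mean|exact: L2_comp].
move/L2P: fL => [fr fi]; move/L2P: gL => [gr gi].
by congr ((_ + _) +i* (_ - _));
  [exact: adj fr gr|exact: adj fi gi|exact: adj fi gr|exact: adj fr gi].
Qed.

(** The Radon-Nikodym derivative of the image measure of mu by phi. *)
Definition fiber_ratio (z : X) : R :=
  fine (mu (fiber phi z)) / fine (mu [set z]).

(* Summed over the points w of the fiber, m(w) h(w) = mu(phi^-1 {w}), so that
   the integral is the mass of phi^-1 (phi^-1 {z}). *)
Hypothesis second_difference : forall z,
  fine (mu [set z]) - 2 * fine (mu (fiber phi z)) +
  \int[mu]_(w in fiber phi z) fiber_ratio w = 0.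

(** T* T is the multiplication by h. *)
Lemma fiber_mean_comp (u : X -> R) z :
  fiber_mean mu phi (u \o phi) z = u z * fiber_ratio z.
Proof.
rewrite /fiber_mean /fiber_ratio.
have /eq_Rintegral -> : {in fiber phi z, u \o phi =1 cst (u z)}.
  by move=> w; rewrite inE /fiber /= => ->.
by rewrite Rintegral_cst//; ring.
Qed.

Let m_gt0 z : 0 < fine (mu [set z]).
Proof. by have /andP[m0 moo] := mu_pt z; rewrite fine_gt0// m0. Qed.

Let fiber_fin z : (mu (fiber phi z) < +oo)%E.
Proof.
have /andP[m0 moo] := mu_pt z.
by rewrite (le_lt_trans (mu_fiber_le z))// lte_mul_pinfty.
Qed.

Lemma fiber_ratio_integrable z :
  mu.-integrable (fiber phi z) (EFin \o fiber_ratio).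
Proof.
apply: measurable_bounded_integrable => //.
exists C; split; first exact: num_real.
move=> M CM w _ /=; apply: le_trans (ltW CM).
rewrite /fiber_ratio ger0_norm; last by rewrite divr_ge0 ?fine_ge0.
have /andP[m0 moo] := mu_pt w.
by rewrite ler_pdivrMr// -lee_fin EFinM !fineK// ge0_fin_numE.
Qed.

(** T* maps h * (u \o phi) = T* T (T u) to (2 h - 1) u: the second-difference
    equation enters here. *)
Lemma fiber_mean_comp_ratio (u : X -> R) z :
  fiber_mean mu phi (fun w => u (phi w) * fiber_ratio w) z =
  u z * (2 * fiber_ratio z - 1).
Proof.
rewrite /fiber_mean.
have /eq_Rintegral -> : {in fiber phi z,
    (fun w => u (phi w) * fiber_ratio w) =1 (fun w => u z * fiber_ratio w)}.
  by move=> w; rewrite inE /fiber /= => ->.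
rewrite RintegralZl//; last exact: fiber_ratio_integrable.
have -> : \int[mu]_(w in fiber phi z) fiber_ratio w =
    2 * fine (mu (fiber phi z)) - fine (mu [set z]).
  by have := second_difference z; lra.
by rewrite /fiber_ratio; field; rewrite gt_eqF.
Qed.

Lemma two_isometry_composition_operator : two_isometry mu T.
Proof.
exists cfiber_mean; split; first exact: is_adjoint_cfiber_mean.
move=> f _; apply: aeW => z _.
have meanT (u : X -> R[i]) w : cfiber_mean (T u) w =
    (complex.Re (u w) * fiber_ratio w) +i* (complex.Im (u w) * fiber_ratio w).
  by congr (_ +i* _); [exact: (fiber_mean_comp (fun w => complex.Re (u w)))
                      |exact: (fiber_mean_comp (fun w => complex.Im (u w)))].
have meanTT : cfiber_mean (cfiber_mean (T (T f))) z =
    (complex.Re (f z) * (2 * fiber_ratio z - 1)) +i*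
    (complex.Im (f z) * (2 * fiber_ratio z - 1)).
  have -> : cfiber_mean (T (T f)) =
      (fun w => (complex.Re (f (phi w)) * fiber_ratio w) +i*
                (complex.Im (f (phi w)) * fiber_ratio w)).
    by apply/funext => w; rewrite meanT.
  by congr (_ +i* _);
    [exact: (fiber_mean_comp_ratio (fun w => complex.Re (f w)))
    |exact: (fiber_mean_comp_ratio (fun w => complex.Im (f w)))].
rewrite meanT meanTT mulr_natl mulr2n; case: (f z) => p q.
by apply/eqP; rewrite eq_complex /=; apply/andP; split; apply/eqP; ring.
Qed.

End CompositionOperator.
End ComplexL2Discrete.

(** * The second-difference equation of a 2-isometry *)

Section TwoIsometryNecessary.
Local Open Scope complex_scope.
Context (R : realType) (d : measure_display) (X : measurableType d).
Variable mu : {measure set X -> \bar R}.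
Hypothesis mX : forall A : set X, measurable A.

Definition cindic (A : set X) : X -> R[i] := fun z => (\1_A z)%:C.

Lemma L2_cindic (A : set X) : L2 mu (cindic A) <-> (mu A < +oo)%E.
Proof.
have sqE : (\int[mu]_z (\1_A z ^+ 2)%:E = mu A)%E.
  rewrite -[in RHS](setIT A) -integral_indic//; apply: eq_integral => z _.
  by rewrite indicE; case: (_ \in _); rewrite ?expr1n ?expr0n.
split=> [/L2P -/(_ mX)[+ _]|Aoo].
  by rewrite /sqintegrable /= sqE.
apply/L2P => //; split; rewrite /sqintegrable /= ?sqE//.
by under eq_integral do rewrite expr0n /=; rewrite integral0.
Qed.

Lemma L2dot_cindic (A : set X) :
  L2dot mu (cindic A) (cindic A) = (fine (mu A))%:C.
Proof.
rewrite L2dotE /=; congr (_ +i* _).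
  rewrite /Rintegral -[in RHS](setIT A) -integral_indic//; congr fine.
  apply: eq_integral => z _.
  by rewrite indicE; case: (_ \in _); rewrite !mulr0 ?mulr1 ?addr0.
rewrite (_ : (fun _ => _) = cst 0) ?Rintegral_cst ?mul0r//.
by apply/funext => z /=; rewrite mul0r mulr0 subr0.
Qed.

Lemma L2dot_cindic1 (z : X) (g : X -> R[i]) :
  L2dot mu (cindic [set z]) g = (fine (mu [set z]))%:C * conjc (g z).
Proof.
have pointE (u : X -> R) :
    \int[mu]_w (\1_[set z] w * u w) = fine (mu [set z]) * u z.
  rewrite mulrC -Rintegral_point// [RHS]Rintegral_mkcond.
  by apply: eq_Rintegral => w _; rewrite patchE indicE; case: ifP;
    rewrite ?mul1r ?mul0r.
rewrite L2dotE /=.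
have -> : (fun w => \1_[set z] w * complex.Re (g w) + 0 * complex.Im (g w)) =
    (fun w => \1_[set z] w * complex.Re (g w)).
  by apply/funext => w; rewrite mul0r addr0.
have -> : (fun w => 0 * complex.Re (g w) - \1_[set z] w * complex.Im (g w)) =
    (fun w => \1_[set z] w * - complex.Im (g w)).
  by apply/funext => w; rewrite mul0r sub0r mulrN.
rewrite !pointE; case: (g z) => p q /=.
by congr (_ +i* _); ring.
Qed.

(** A point of positive mass is not negligible. *)
Lemma ae_eq_point (V : Type) (f g : X -> V) z :
  (0 < mu [set z])%E -> f = g %[ae mu] -> f z = g z.
Proof.
move=> mz [N [_ N0 fgN]]; apply: contrapT => fgz.
have zN : [set z] `<=` N.
  by move=> w ->; apply: fgN => /= /(_ Logic.I).
have : (mu [set z] <= mu N)%E by apply: le_measure; rewrite ?inE.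
by rewrite [mu N]N0 leNgt mz.
Qed.

Variable phi : X -> X.
Let T := @composition_operator X R[i] phi.
Hypothesis mu_pt : forall z, (0 < mu [set z] < +oo)%E.
Hypothesis bT : bounded_operator mu T.

(** The composition with phi maps the indicator of A to that of its preimage. *)
Lemma bounded_preimage_fin (A : set X) :
  (mu A < +oo)%E -> (mu (phi @^-1` A) < +oo)%E.
Proof. by case: bT => TL _ _ /L2_cindic/TL/L2_cindic. Qed.

(** With e the indicator of {z}, the equation is the pairing of e with
    e - 2 T* T e + T*^2 T^2 e, since <e, T* T e> = <T e, T e> and
    <e, T*^2 T^2 e> = <T^2 e, T^2 e>, and T e, T^2 e are indicators too. *)
Lemma two_isometry_second_difference z : two_isometry mu T ->
  fine (mu [set z]) - 2 * fine (mu (phi @^-1` [set z])) +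
  fine (mu (phi @^-1` (phi @^-1` [set z]))) = 0.
Proof.
move=> [S [[SL adj] iso]].
have /andP[m0 moo] := mu_pt z.
have eL : L2 mu (cindic [set z]) by exact/L2_cindic.
have TL f : L2 mu f -> L2 mu (T f) by case: bT => + _ _; exact.
have TeL := TL _ eL; have TTeL := TL _ TeL.
have := ae_eq_point m0 (iso _ eL); rewrite /cst /=.
have h1 : (fine (mu [set z]))%:C * conjc (S (T (cindic [set z])) z) =
    (fine (mu (phi @^-1` [set z])))%:C.
  by rewrite -L2dot_cindic1 -adj// -L2dot_cindic.
have h2 : (fine (mu [set z]))%:C *
    conjc (S (S (T (T (cindic [set z])))) z) =
    (fine (mu (phi @^-1` (phi @^-1` [set z]))))%:C.
  rewrite -L2dot_cindic1 -adj//; last exact: SL.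
  by rewrite -adj// -L2dot_cindic.
have -> : cindic [set z] z = 1 by rewrite /cindic indicE mem_set.
move=> h0.
have : (fine (mu [set z]))%:C * conjc (1 - 2 * S (T (cindic [set z])) z +
    S (S (T (T (cindic [set z])))) z) = 0 by rewrite h0 conjc0 mulr0.
rewrite rmorphD rmorphB rmorphM rmorph1 rmorph_nat mulrDr mulrBr mulr1.
rewrite mulrCA h1 h2 mulr_natl mulr2n => /(congr1 (@complex.Re R)) /= h.
by rewrite -[RHS]h; ring.
Qed.

End TwoIsometryNecessary.

(** * Necessity for the one-circuit form *)

Section OneCircuitNecessary.
Context (R : realType) (d : measure_display) (X : measurableType d).
Variable mu : {measure set X -> \bar R}.
Variables (kappa : nat) (eta : option nat) (phi : X -> X)
  (x : nat -> X) (y : nat -> nat -> X).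
Hypothesis hkappa : (1 < kappa)%N.
Hypothesis heta : forall n : nat, eta = Some n -> (1 <= n)%N.
Hypothesis circ : one_circuit_form kappa eta phi x y.

Lemma in_J1 : in_J eta 1.
Proof. by rewrite /in_J; case: eta heta => // n /(_ n erefl). Qed.

Lemma preimage_circuit_point i : (1 <= i < kappa)%N ->
  phi @^-1` [set x i] = [set x i.+1].
Proof.
case: circ => cov xI yI xy py py1 px1 px ik; apply/seteqP; split => w /=.
  case: (cov w) => [[j jk ->]|[p [q [pJ q1 ->]]]].
    have [j2|j1] := ltnP 1 j.
      rewrite px ?j2; last by lia.
      by move=> /xI jE; rewrite -jE; [rewrite prednK//; lia|lia|lia].
    have -> : j = 1%N by lia.
    by rewrite px1 => /xI kE; have := kE _ _; lia.
  have [q2|q1'] := ltnP 1 q.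
    by rewrite py// => /esym /xy; case => //; lia.
  have -> : q = 1%N by lia.
  by rewrite py1// => /xI kE; have := kE _ _; lia.
by move=> ->; rewrite px//; lia.
Qed.

Variable a : nat -> R.
Hypothesis disc : discrete_measure_space mu.
Hypothesis mu_x :
  forall n : nat, (1 <= n <= kappa)%N -> mu [set x n] = (a n)%:E.
Hypothesis bT : bounded_operator mu (@composition_operator X R[i] phi).
Hypothesis isoT : two_isometry mu (@composition_operator X R[i] phi).

Lemma circuit_second_difference i : (1 <= i)%N -> (i.+2 <= kappa)%N ->
  a i - 2 * a i.+1 + a i.+2 = 0.
Proof.
move=> i1 ik; case: disc => mX mu_pt.
have := two_isometry_second_difference mX mu_pt bT (x i) isoT.
by rewrite preimage_circuit_point ?preimage_circuit_point ?mu_x//=; lia.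
Qed.

(** The number p is the mass of the preimage of x_kappa, which contains x_1 and
    the entry point x_(1,1) of the first branch; the equation is the one at
    x_(kappa-1). *)
Lemma circuit_entry_mass_gt :
  exists2 p, a 1%N < p & a kappa.-1 - 2 * a kappa + p = 0.
Proof.
case: disc => mX mu_pt; pose P := phi @^-1` [set x kappa].
have k1 : kappa.-1.+1 = kappa by lia.
exists (fine (mu P)); last first.
  have := two_isometry_second_difference mX mu_pt bT (x kappa.-1) isoT.
  rewrite preimage_circuit_point; last by lia.
  by rewrite k1 !mu_x//=; lia.
(* Boundedness of the operator is what makes this preimage, possibly infinite,
   of finite mass. *)
have Poo : (mu P < +oo)%E.
  by apply: bounded_preimage_fin => //; case/andP: (mu_pt (x kappa)).
have /andP[my0 myoo] := mu_pt (y 1%N 1%N).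
rewrite -lte_fin fineK ?ge0_fin_numE//.
have sub : [set x 1%N] `|` [set y 1%N 1%N] `<=` P.
  move=> w [->|->]; rewrite /P /=; first exact: (circuit_phi_x1 circ).
  exact: (circuit_phi_y1 circ in_J1).
suff sum_gt : ((a 1%N)%:E < mu ([set x 1%N] `|` [set y 1%N 1%N]))%E.
  by apply: (lt_le_trans sum_gt); apply: le_measure; rewrite ?inE.
have -> : mu ([set x 1%N] `|` [set y 1%N 1%N]) =
    (mu [set x 1%N] + mu [set y 1%N 1%N])%E.
  apply: measureU => //; apply/seteqP; split => // w [-> /esym yx].
  by apply: (circuit_x_neq_y circ _ in_J1 _ (esym yx)) => //; lia.
rewrite mu_x; last by lia.
by rewrite lteDl// fin_numElt.
Qed.

Lemma circuit_masses_arithmetic :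
  (forall m n : nat, (1 <= m <= kappa.-1)%N -> (1 <= n <= kappa.-1)%N ->
      forward_diff a m = forward_diff a n) /\ 0 < forward_diff a 1.
Proof.
have diffS n : (n.+2 <= kappa)%N -> forward_diff a n.+1 = forward_diff a 1.
  elim: n => // n IH nk; rewrite -IH; last by lia.
  by have := @circuit_second_difference n.+1 isT nk; rewrite /forward_diff; lra.
have aE n : (n.+1 <= kappa)%N -> a n.+1 = a 1%N + n%:R * forward_diff a 1.
  elim: n => [_|n IH nk]; first by rewrite mul0r addr0.
  have := IH (ltnW nk); have := diffS n nk; rewrite /forward_diff -natr1.
  lra.
split.
  by move=> [|m] [|n]// hm hn; rewrite !diffS//; lia.
have [p pa pE] := circuit_entry_mass_gt.
case: kappa hkappa pE aE => [//|[//|k]] _ /= pE aE.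
have := aE k.+1 (leqnn _); have := aE k (leqnSn _).
rewrite -natr1 => e1 e2.
have k0 : 0 <= k%:R :> R by exact: ler0n.
(* kappa * delta = p - a_1 > 0, with kappa = k + 2. *)
have : 0 < (k%:R + 2) * forward_diff a 1 by lra.
by rewrite pmulr_rgt0//; lra.
Qed.

End OneCircuitNecessary.

(** * Measures with prescribed point masses *)

Section WeightedCounting.
Context (d : measure_display) (X : measurableType d) (R : realType).
Variable w : X -> R.
Hypothesis w_ge0 : forall z, 0 <= w z.

Definition weighted_counting (A : set X) : \bar R := \esum_(z in A) (w z)%:E.

Let weighted_counting0 : weighted_counting set0 = 0%E.
Proof. exact: esum_set0. Qed.

Let weighted_counting_ge0 A : (0 <= weighted_counting A)%E.
Proof. by apply: esum_ge0 => z _; rewrite lee_fin. Qed.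

Let weighted_counting_sigma_additive : semi_sigma_additive weighted_counting.
Proof.
move=> F _ tF _; rewrite /weighted_counting nneseries_sum_bigcup//.
by apply: is_cvg_nneseries => n _ _; exact: weighted_counting_ge0.
Qed.

Lemma weighted_counting_measure : exists mu : {measure set X -> \bar R},
  forall z, mu [set z] = (w z)%:E.
Proof.
pose M := isMeasure.Build d X R weighted_counting weighted_counting0
  weighted_counting_ge0 weighted_counting_sigma_additive.
pose mu : {measure set X -> \bar R} := HB.pack weighted_counting M.
by exists mu => z; rewrite -[LHS]/(weighted_counting [set z])
  /weighted_counting esum_set1// lee_fin.
Qed.

End WeightedCounting.

(** * The model of the one-circuit form *)

(** With kappa = k.+1, the pair (0, i) stands for x_(i+1), and (i, j) with i > 0
    stands for x_(i,j+1): all second components are shifted to start at 0. *)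
Definition circuit_pred (k : nat) (eta : option nat) (p : nat * nat) : bool :=
  if p.1 == 0%N then (p.2 <= k)%N else in_J eta p.1.

Definition circuit (k : nat) (eta : option nat) : Type :=
  {p : nat * nat | circuit_pred k eta p}.

HB.instance Definition _ k eta := Countable.on (circuit k eta).

Definition circuit_origin k eta : circuit k eta :=
  exist (circuit_pred k eta) (0%N, 0%N) isT.

HB.instance Definition _ k eta :=
  isPointed.Build (circuit k eta) (circuit_origin k eta).

HB.instance Definition _ k eta :=
  @isMeasurable.Build default_measure_display (circuit k eta)
    discrete_measurable discrete_measurable0
    discrete_measurableC discrete_measurableU.

Section CircuitModel.
Variables (k : nat) (eta : option nat).
Hypothesis J1 : in_J eta 1.
Local Notation V := (circuit k eta).

(** Since the second components start at 0, the map is the decrement on the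
    circuit and on every branch, and sends each starting point to x_kappa. *)
Definition step (p : nat * nat) : nat * nat :=
  if p.2 is j.+1 then (p.1, j) else (0%N, k).

Lemma step_circuit p : circuit_pred k eta p -> circuit_pred k eta (step p).
Proof.
by case: p => i [|j]; rewrite /circuit_pred /step//=; case: eqP => // _ /ltnW.
Qed.

Definition circuit_map (z : V) : V :=
  exist (circuit_pred k eta) (step (val z)) (step_circuit (valP z)).

Definition pt (p : nat * nat) : V := insubd (circuit_origin k eta) p.

Lemma val_pt p : circuit_pred k eta p -> val (pt p) = p.
Proof. by move=> pP; rewrite val_insubd pP. Qed.

Lemma pt_val (z : V) : pt (val z) = z.
Proof. by rewrite /pt valKd. Qed.

Lemma circuit_map_pt p : circuit_pred k eta p ->
  circuit_map (pt p) = pt (step p).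
Proof.
by move=> pP; apply: val_inj; rewrite /= !val_pt//; exact: step_circuit.
Qed.

Definition circ_x (i : nat) : V := pt (0%N, i.-1).
Definition circ_y (i j : nat) : V := pt (i, j.-1).

Lemma pred_x i : (1 <= i <= k.+1)%N -> circuit_pred k eta (0%N, i.-1).
Proof. by case: i. Qed.

Lemma pred_y i j : in_J eta i -> circuit_pred k eta (i, j).
Proof. by case: i => [|i]. Qed.

Lemma circuit_one_circuit_form :
  one_circuit_form k.+1 eta circuit_map circ_x circ_y.
Proof.
split.
- move=> z; rewrite -(pt_val z); move: (valP z).
  case: (val z) => [[|i] j]; rewrite /circuit_pred /= => zP.
    by left; exists j.+1 => //; lia.
  by right; exists i.+1, j.+1.
- move=> i i' ik ik' /(congr1 val); rewrite !val_pt ?pred_x// => -[]; lia.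
- move=> i j i' j' iJ j1 iJ' j1' /(congr1 val).
  by rewrite !val_pt ?pred_y// => -[-> ?]; split => //; lia.
- move=> i i' j ik iJ j1 /(congr1 val).
  by rewrite !val_pt ?pred_x ?pred_y// => -[iE]; move: iJ; rewrite -iE.
- by move=> i [|[|j]] iJ // _; rewrite circuit_map_pt ?pred_y.
- by move=> i iJ; rewrite circuit_map_pt ?pred_y.
- by rewrite circuit_map_pt ?pred_x.
- by move=> [|[|i]] // ik; rewrite circuit_map_pt// pred_x//; lia.
Qed.

Lemma fiber_pt i j : circuit_pred k eta (i, j.+1) ->
  fiber circuit_map (pt (i, j)) = [set pt (i, j.+1)].
Proof.
move=> ijP; have ijP' : circuit_pred k eta (i, j) by exact: step_circuit ijP.
apply/seteqP; split => z; last by move=> ->; rewrite /fiber/= circuit_map_pt.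
rewrite /fiber /= -(pt_val z) circuit_map_pt ?(valP z)// => /(congr1 val).
rewrite !val_pt ?step_circuit ?(valP z)//.
case: (val z) (valP z) => i' [|j'] /= zP; last by move=> [-> ->].
by move=> [iE jE]; move: ijP; rewrite /circuit_pred -iE -jE /= ltnn.
Qed.

(** The points x_(i,1), through which the branches enter the circuit. *)
Definition entries : set V := [set z | (0 < (val z).1)%N /\ (val z).2 = 0%N].

Lemma fiber_top :
  fiber circuit_map (pt (0%N, k)) = [set pt (0%N, 0%N)] `|` entries.
Proof.
apply/seteqP; split => z.
  rewrite /fiber /= -(pt_val z) circuit_map_pt ?(valP z)// => /(congr1 val).
  rewrite !val_pt ?step_circuit ?(valP z)//; last by rewrite /circuit_pred /=.
  case: (val z) (valP z) => [[|i] [|j]] /= zP //; first by left.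
    by move=> [jE]; move: zP; rewrite /circuit_pred /= jE ltnn.
  by move=> _; right; rewrite /entries/= val_pt.
move=> [->|]; first by rewrite /fiber /= circuit_map_pt.
rewrite /entries /= -(pt_val z) val_pt ?(valP z)//.
case: (val z) (valP z) => i j /= zP [_ j0].
by rewrite /fiber /= circuit_map_pt//= /step j0.
Qed.

Variable R : realType.

(** Its consecutive differences are positive exactly on J_[1,eta], shifted to
    start at 0, and sum up to 1. *)
Definition cutoff_harmonic (n : nat) : R :=
  if in_J eta n.+1 then n.+1%:R^-1 else 0.

Lemma cutoff_harmonic_ge0 n : 0 <= cutoff_harmonic n.
Proof. by rewrite /cutoff_harmonic; case: ifP. Qed.

Lemma in_J_pred n : in_J eta n.+2 -> in_J eta n.+1.
Proof. by rewrite /in_J; case: eta => // m /andP[_ /ltnW]. Qed.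

Lemma cutoff_harmonic_decr n : in_J eta n.+1 ->
  cutoff_harmonic n.+1 < cutoff_harmonic n.
Proof.
move=> nJ; rewrite /cutoff_harmonic nJ; case: ifP => _; last first.
  by rewrite invr_gt0 ltr0n.
by rewrite ltf_pV2 ?posrE ?ltr0n// ltr_nat.
Qed.

Lemma cutoff_harmonic_le n : cutoff_harmonic n <= n.+1%:R^-1.
Proof. by rewrite /cutoff_harmonic; case: ifP. Qed.

Lemma cutoff_harmonic_cvg : cutoff_harmonic @ \oo --> 0.
Proof.
apply: (squeeze_cvgr (f := cst 0) (h := harmonic)).
- by apply: nearW => n; rewrite cutoff_harmonic_ge0 cutoff_harmonic_le.
- exact: cvg_cst.
- exact: cvg_harmonic.
Qed.

Lemma cutoff_harmonic_series (c : R) :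
  (\sum_(n <oo) (c * (cutoff_harmonic n - cutoff_harmonic n.+1))%:E = c%:E)%E.
Proof.
apply/cvg_lim => //.
rewrite (_ : (fun _ => _) =
    EFin \o (fun n => c * (1 - cutoff_harmonic n))); last first.
  apply/funext => n /=; rewrite sumEFin -big_distrr /=; congr (_ * _)%:E.
  under eq_bigr do rewrite -opprB.
  rewrite sumrN telescope_sumr// opprB.
  by rewrite [X in X - _ = _]/cutoff_harmonic J1 invr1.
apply: cvg_EFin; first by apply: nearW.
have : c * (1 - cutoff_harmonic n) @[n --> \oo] --> c * (1 - 0).
  apply: cvgM; first exact: cvg_cst.
  by apply: cvgB; [exact: cvg_cst|exact: cutoff_harmonic_cvg].
by rewrite subr0 mulr1.
Qed.

Variables (c delta : R).
Hypotheses (c_gt0 : 0 < c) (delta_gt0 : 0 < delta).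

(** The arithmetic sequence a_(j+1), continued beyond j = k so as to give the
    masses of the fibers over the circuit. *)
Definition circle_mass (j : nat) : R := c + j%:R * delta.

(** The branch i has constant mass, and the entry points have the total mass
    kappa * delta. *)
Definition mass (p : nat * nat) : R :=
  if p.1 is i.+1 then
    k.+1%:R * delta * (cutoff_harmonic i - cutoff_harmonic i.+1)
  else circle_mass p.2.

Lemma circle_mass_gt0 j : 0 < circle_mass j.
Proof. by rewrite ltr_pwDl// mulr_ge0// ltW. Qed.

Lemma mass_gt0 (z : V) : 0 < mass (val z).
Proof.
case: (val z) (valP z) => [[|i] j] zP; first exact: circle_mass_gt0.
by rewrite /mass /= !mulr_gt0// subr_gt0 cutoff_harmonic_decr.
Qed.

Variable mu : {measure set V -> \bar R}.
Hypothesis muE : forall z, mu [set z] = (mass (val z))%:E.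

Let mu_pt z : (0 < mu [set z] < +oo)%E.
Proof. by rewrite muE lte_fin mass_gt0 ltry. Qed.

Let mX (A : set V) : measurable A.
Proof. by []. Qed.

Lemma mu_entries : mu entries = (k.+1%:R * delta)%:E.
Proof.
pose E n : set V := [set z | val z = (n.+1, 0%N)].
have -> : entries = \bigcup_n E n.
  apply/seteqP; split => z; last by move=> [n _]; rewrite /E /entries /= => ->.
  rewrite /entries /E /=; case zE : (val z) => [[|i] j] /= [] // _ j0.
  by exists i => //; rewrite -j0; exact: zE.
rewrite measure_semi_bigcup//; last first.
  by move=> i j _ _ [z []]; rewrite /E /= => -> [].
rewrite -(cutoff_harmonic_series (k.+1%:R * delta)).
apply: eq_eseriesr => n _.
have [nJ|nJ] := boolP (in_J eta n.+1).
  rewrite (_ : E n = [set pt (n.+1, 0%N)]) ?muE ?val_pt ?pred_y//.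
  apply/seteqP; split => z; last by move=> ->; rewrite /E /= val_pt ?pred_y.
  by move=> zE; rewrite -(pt_val z) [val z]zE.
rewrite (_ : E n = set0) ?measure0.
  rewrite /cutoff_harmonic (negbTE nJ).
  rewrite (_ : in_J eta n.+2 = false) ?subrr ?mulr0//.
  by apply/negP => /in_J_pred; rewrite (negbTE nJ).
apply/seteqP; split => // z zE.
by move: (valP z); rewrite [val z]zE /circuit_pred /= (negbTE nJ).
Qed.

(** At the top of the circuit, x_1 and the entry points together have the mass
    c + (k + 1) delta, which is the next term of the arithmetic sequence. *)
Lemma mu_fiber (z : V) : mu (fiber circuit_map z) =
  (if (val z).1 == 0%N then circle_mass (val z).2.+1 else mass (val z))%:E.
Proof.
rewrite -(pt_val z); move: (valP z); case: (val z) => i j ijP.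
rewrite !val_pt//=.
have [i0|i0] := eqVneq i 0%N; last first.
  rewrite fiber_pt; last by move: ijP; rewrite /circuit_pred /= (negbTE i0).
  rewrite muE val_pt; last by move: ijP; rewrite /circuit_pred /= (negbTE i0).
  by case: i i0 ijP.
subst i; move: ijP; rewrite /circuit_pred /= leq_eqVlt => /orP[/eqP ->|jk].
  rewrite fiber_top measureU//; last first.
    by apply/seteqP; split => // w [-> []]; rewrite val_pt.
  rewrite [X in (X + _)%E]muE val_pt// [X in (_ + X)%E]mu_entries -EFinD.
  by rewrite /mass /circle_mass /= mul0r addr0.
by rewrite fiber_pt ?muE ?val_pt.
Qed.

Let fiber_bound_ge0 : 0 <= 1 + delta / c.
Proof. by rewrite addr_ge0// divr_ge0// ltW. Qed.

(** The ratio is 1 on the branches and 1 + delta / circle_mass j on the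
    circuit, where it is largest at j = 0. *)
Lemma circuit_fiber_le z : (mu (fiber circuit_map z) <=
  (1 + delta / c)%:E * mu [set z])%E.
Proof.
rewrite mu_fiber muE -EFinM lee_fin.
have dc0 : 0 < delta / c by rewrite divr_gt0.
case: ifP => [/eqP z0|_]; last first.
  by rewrite ler_peMl ?lerDl ?(ltW dc0)// ltW// mass_gt0.
rewrite /mass z0 /circle_mass mulrDl mul1r -natr1.
rewrite -subr_ge0.
have -> : c + (val z).2%:R * delta + delta / c * (c + (val z).2%:R * delta) -
   (c + ((val z).2%:R + 1) * delta) = delta / c * ((val z).2%:R * delta).
  by field; rewrite gt_eqF.
by apply: mulr_ge0; [exact: ltW|rewrite mulr_ge0// ltW].
Qed.

(** Over a one-point fiber {w} the integral of the ratio is mu (fiber w); over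
    the top of the circuit it is mu (fiber x_1) plus the mass of the entry points,
    where the ratio is 1.  In all cases three consecutive terms of an arithmetic
    or constant sequence are left. *)
Lemma circuit_second_diff z :
  fine (mu [set z]) - 2 * fine (mu (fiber circuit_map z)) +
  \int[mu]_(w in fiber circuit_map z) fiber_ratio mu circuit_map w = 0.
Proof.
have ratio_pt w : fiber_ratio mu circuit_map w * fine (mu [set w]) =
    fine (mu (fiber circuit_map w)).
  by rewrite /fiber_ratio divfK// muE /= gt_eqF// mass_gt0.
rewrite mu_fiber muE /=.
rewrite -(pt_val z); move: (valP z); case: (val z) => i j ijP.
rewrite !val_pt//=.
have [i0|i0] := eqVneq i 0%N; last first.
  have ijP' : circuit_pred k eta (i, j.+1).
    by move: ijP; rewrite /circuit_pred /= (negbTE i0).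
  rewrite fiber_pt// Rintegral_point// ratio_pt mu_fiber val_pt//= (negbTE i0).
  by case: i i0 ijP ijP' => // i _ _ _; rewrite /mass /=; ring.
subst i; move: ijP; rewrite /circuit_pred /= leq_eqVlt => /orP[/eqP ->|jk].
  rewrite fiber_top Rintegral_setU//; last 2 first.
  - rewrite -fiber_top.
    exact: (fiber_ratio_integrable mX mu_pt fiber_bound_ge0 circuit_fiber_le).
  - by apply/eqP; apply/seteqP; split => // w [-> []]; rewrite val_pt.
  rewrite Rintegral_point// ratio_pt mu_fiber val_pt//=.
  have /eq_Rintegral -> : {in entries, fiber_ratio mu circuit_map =1 cst 1}.
    move=> w; rewrite inE /entries /= => -[w1 _].
    rewrite /fiber_ratio mu_fiber muE /= gtn_eqF// divff// gt_eqF//.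
    exact: mass_gt0.
  rewrite Rintegral_cst// [mu _]mu_entries /= /mass /circle_mass /=.
  by rewrite -natr1; ring.
rewrite fiber_pt// Rintegral_point// ratio_pt mu_fiber val_pt//=.
by rewrite /mass /circle_mass /= -!natr1; ring.
Qed.

End CircuitModel.

Unset Implicit Arguments.

Theorem proposition3p7 (R : realType) (kappa : nat) (eta : option nat)
    (a : nat -> R)
    (hkappa : (1 < kappa)%N)
    (heta : forall n : nat, eta = Some n -> (1 <= n)%N)
    (ha : forall n : nat, (1 <= n <= kappa)%N -> 0 < a n) :
  (exists (d : measure_display) (X : measurableType d)
      (mu : {measure set X -> \bar R}) (phi : X -> X)
      (x : nat -> X) (y : nat -> nat -> X),
    [/\ discrete_measure_space mu,
        one_circuit_form kappa eta phi x y,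
        forall n : nat, (1 <= n <= kappa)%N -> mu [set x n] = (a n)%:E,
        bounded_operator mu (@composition_operator X R[i] phi)
      & two_isometry mu (@composition_operator X R[i] phi)])
  <->
  ((forall m n : nat, (1 <= m <= kappa.-1)%N -> (1 <= n <= kappa.-1)%N ->
      forward_diff a m = forward_diff a n) /\
   0 < forward_diff a 1).
Proof.
split=> [[d [X [mu [phi [x [y [disc circ mu_x bT isoT]]]]]]]|].
  exact: (circuit_masses_arithmetic hkappa heta circ disc mu_x bT isoT).
move=> [diffE delta_gt0].
have J1 := in_J1 heta.
case: kappa hkappa ha diffE => [//|k] /= k0 ha diffE.
have aE n : (n <= k)%N -> a n.+1 = circle_mass (a 1%N) (forward_diff a 1) n.
  elim: n => [_|n IH nk]; first by rewrite /circle_mass mul0r addr0.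
  have := diffE n.+1 1%N nk k0; have := IH (ltnW nk).
  by rewrite /circle_mass /forward_diff -natr1; lra.
have c_gt0 : 0 < a 1%N by exact: ha.
have w_gt0 := @mass_gt0 k eta R _ _ c_gt0 delta_gt0.
have [mu muE] := @weighted_counting_measure _ (circuit k eta) R _
  (fun z => ltW (w_gt0 z)).
have mX (A : set (circuit k eta)) : measurable A by [].
have mu_pt z : (0 < mu [set z] < +oo)%E by rewrite muE lte_fin w_gt0 ltry.
have codeI : injective (pickle : circuit k eta -> nat).
  exact: (pcan_inj pickleK).
have C0 : 0 <= 1 + forward_diff a 1 / a 1%N.
  by rewrite addr_ge0// divr_ge0// ltW.
have fiber_le := circuit_fiber_le J1 c_gt0 delta_gt0 muE.
exists default_measure_display, (circuit k eta), mu, (@circuit_map k eta).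
exists (@circ_x k eta), (@circ_y k eta); split.
- by split.
- exact: circuit_one_circuit_form.
- move=> [|n]// nk; rewrite muE /circ_x val_pt /=; last exact: (pred_x eta nk).
  by rewrite (aE n nk).
- exact: (bounded_composition_operator mX codeI C0 fiber_le).
- apply: (two_isometry_composition_operator mX codeI mu_pt C0 fiber_le).
  exact: (circuit_second_diff J1 c_gt0 delta_gt0 muE).
Qed.
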